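(* Let $X=\{x\in\mathbb{R}^n\mid G(x)\le 0\}$ for a continuously differentiable function $G\colon\mathbb{R}^n\to\mathbb{R}^q$. Let $(\bar x,\bar y,\bar u)\in\mathbb{R}^n\times\mathbb{R}^m\times\mathbb{R}^p$ be a feasible point of the Lagrange dual reformulation (LD), i.e., a point satisfying $\bar x\in X$, $g(\bar x,\bar y)\le 0$, $\bar u\ge 0$, $f(\bar x,\bar y)\le\psi_\ell(\bar x,\bar u)$. Define $\chi\colon\mathbb{R}^n\times\mathbb{R}^m\times\mathbb{R}^p\to\mathbb{R}\cup\{-\infty,\infty\}$ by $\chi(x,y,u):=f(x,y)-\psi_\ell(x,u)$ and $$\mathcal{F}:=\{(x,y,u)\in\mathbb{R}^n\times\mathbb{R}^m\times\mathbb{R}^p\mid g(x,y)\le 0,\ u\ge 0\}.$$ Assume that $$\partial^\infty\chi(\bar x,\bar y,\bar u)\cap\bigl(-N_{\mathcal{F}}(\bar x,\bar y,\bar u)\bigr)=\{(0,0,0)\}.$$ Then NSMFCQ is violated at $(\bar x,\bar y,\bar u)$ for the constraint system of (LD), that is, for the system of inequalities $G(x)\le 0$, $g(x,y)\le 0$, $-u\le 0$, $\chi(x,y,u)\le 0$.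
   Context: Let $f\colon\mathbb{R}^n\times\mathbb{R}^m\to\mathbb{R}$ and $g\colon\mathbb{R}^n\times\mathbb{R}^m\to\mathbb{R}^p$ be twice continuously differentiable such that, for each $x\in X$, $f(x,\cdot),g_1(x,\cdot),\ldots,g_p(x,\cdot)$ are convex. Vector inequalities are componentwise. Let $L(x,y,u):=f(x,y)+u^\top g(x,y)$, and let $\psi_\ell(x,u):=\inf_y\{L(x,y,u)\mid y\in\mathbb{R}^m\}$ if $u\ge 0$, $\psi_\ell(x,u):=-\infty$ otherwise. The function $\psi_\ell$ is upper semicontinuous. (LD): $\min_{x,y,u}\{F(x,y)\mid x\in X,\ g(x,y)\le 0,\ u\ge 0,\ f(x,y)\le\psi_\ell(x,u)\}$, where $F\colon\mathbb{R}^n\times\mathbb{R}^m\to\mathbb{R}$ is a given continuously differentiable objective (it plays no role for the constraint qualification). Limiting normal cone: for closed $\Omega\subset\mathbb{R}^s$ and $w\in\Omega$, $N_\Omega(w)$ is the set of all $\eta\in\mathbb{R}^s$ for which there are sequences $w^k\to w$ in $\mathbb{R}^s$, $v^k\in\Pi_\Omega(w^k)$ and $\alpha_k>0$ with $\alpha_k(w^k-v^k)\to\eta$; here $\Pi_\Omega(w')$ is the set of Euclidean nearest points to $w'$ in $\Omega$. Subdifferentials: for lower semicontinuous $p\colon\mathbb{R}^s\to\mathbb{R}\cup\{\pm\infty\}$ and $w$ with $|p(w)|<\infty$, with $\operatorname{epi}p:=\{(w,\alpha)\in\mathbb{R}^s\times\mathbb{R}\mid\alpha\ge p(w)\}$,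 the limiting and singular subdifferentials are $\partial p(w):=\{\eta\mid(\eta,-1)\in N_{\operatorname{epi}p}(w,p(w))\}$ and $\partial^\infty p(w):=\{\eta\mid(\eta,0)\in N_{\operatorname{epi}p}(w,p(w))\}$. NSMFCQ: for a system $q_i(w)\le 0$, $i=1,\ldots,\nu$, with lower semicontinuous $q_i\colon\mathbb{R}^s\to\mathbb{R}\cup\{\pm\infty\}$, NSMFCQ holds at a feasible point $\bar w$ at which all $q_i$ are finite if the conditions $0\in\sum_{i=1}^\nu v_i\,\partial q_i(\bar w)$ and $v_i\ge 0$, $v_i\,q_i(\bar w)=0$ for all $i$ possess only the trivial solution $v_1=\dots=v_\nu=0$; it is violated at $\bar w$ otherwise. For continuously differentiable $q_i$, $\partial q_i(\bar w)=\{\nabla q_i(\bar w)\}$. *)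

(* Defs.v *)
From HB Require Import structures.
From mathcomp Require Import all_boot all_order all_algebra.
From mathcomp Require Import all_classical all_reals all_analysis.

Set Implicit Arguments.
Unset Strict Implicit.
Unset Printing Implicit Defensive.

Import Order.TTheory GRing.Theory Num.Theory.
Import numFieldNormedType.Exports.

Local Open Scope classical_set_scope.
Local Open Scope ring_scope.

Section VariationalAnalysis.
Context {R : realType}.

Definition vec_le s (u v : 'rV[R]_s) : bool := [forall i, u 0 i <= v 0 i].

Definition grad s (h : 'rV[R]_s -> R) (w : 'rV[R]_s) : 'rV[R]_s :=
  \row_i 'D_(delta_mx 0 i) h w.

Definition C1 s (h : 'rV[R]_s -> R) : Prop :=
  (forall w, differentiable h w) /\ continuous (grad h).

Definition C2 s (h : 'rV[R]_s -> R) : Prop :=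
  C1 h /\ forall i, C1 (fun w => grad h w 0 i).

(* The library norm on row vectors is the sup norm, which induces the Euclidean
   topology but not the Euclidean nearest points. *)
Definition enorm s (w : 'rV[R]_s) : R := Num.sqrt (\sum_i w 0 i ^+ 2).

Definition proj_set s (Omega : set 'rV[R]_s) (w : 'rV[R]_s) : set 'rV[R]_s :=
  [set v | Omega v /\ forall v', Omega v' -> enorm (w - v) <= enorm (w - v')].

(* Only meaningful for closed Omega and w in Omega. *)
Definition limiting_normal_cone s (Omega : set 'rV[R]_s) (w : 'rV[R]_s) :
    set 'rV[R]_s :=
  [set eta | exists (wk vk : nat -> 'rV[R]_s) (alpha : nat -> R),
    [/\ wk @ \oo --> w,
        forall k, proj_set Omega (wk k) (vk k),
        forall k, 0 < alpha k
      & (fun k => alpha k *: (wk k - vk k)) @ \oo --> eta]].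

(* R^s x R is identified with R^(s+1), the last coordinate being the height. *)
Definition epigraph s (h : 'rV[R]_s -> \bar R) : set 'rV[R]_(s + 1) :=
  [set z | (h (lsubmx z) <= (rsubmx z 0 0)%:E)%E].

(* In both subdifferentials, fine (h w) is the value h(w), which is meant to be
   finite. *)
Definition limiting_subdiff s (h : 'rV[R]_s -> \bar R) (w : 'rV[R]_s) :
    set 'rV[R]_s :=
  [set eta | limiting_normal_cone (epigraph h)
     (row_mx w (fine (h w))%:M) (row_mx eta (-1)%:M)].

Definition singular_subdiff s (h : 'rV[R]_s -> \bar R) (w : 'rV[R]_s) :
    set 'rV[R]_s :=
  [set eta | limiting_normal_cone (epigraph h)
     (row_mx w (fine (h w))%:M) (row_mx eta 0%:M)].

(* eta i is the element chosen in the i-th summand of the Minkowski sum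
   \sum_i v i * limiting_subdiff (q i) w. *)
Definition NSMFCQ (I : finType) s (q : I -> 'rV[R]_s -> \bar R)
    (w : 'rV[R]_s) : Prop :=
  forall (v : I -> R) (eta : I -> 'rV[R]_s),
    (forall i, limiting_subdiff (q i) w (eta i)) ->
    \sum_i v i *: eta i = 0 ->
    (forall i, 0 <= v i) ->
    (forall i, ((v i)%:E * q i w)%E = 0%E) ->
    forall i, v i = 0.

(* The qualification is only defined at feasible points at which all the
   constraint functions are finite, so a violation includes both properties. *)
Definition NSMFCQ_violated (I : finType) s (q : I -> 'rV[R]_s -> \bar R)
    (w : 'rV[R]_s) : Prop :=
  [/\ forall i, (q i w <= 0)%E,
      forall i, q i w \is a fin_num
    & ~ NSMFCQ q w].

End VariationalAnalysis.

(* R^n x R^m is identified with R^(n+m) through row_mx, and R^n x R^m x R^p with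
   R^((n+m)+p). *)
Section LagrangeDualReformulation.
Context {R : realType} {n m p q : nat}.
Variables (f : 'rV[R]_(n + m) -> R) (g : 'rV[R]_(n + m) -> 'rV[R]_p).
Variable G : 'rV[R]_n -> 'rV[R]_q.

Definition upper_set : set 'rV[R]_n := [set x | vec_le (G x) 0].

Definition Lagrangian (x : 'rV[R]_n) (y : 'rV[R]_m) (u : 'rV[R]_p) : R :=
  f (row_mx x y) + \sum_i u 0 i * g (row_mx x y) 0 i.

Definition psi_l (x : 'rV[R]_n) (u : 'rV[R]_p) : \bar R :=
  if vec_le 0 u
  then ereal_inf [set (Lagrangian x y u)%:E | y in [set: 'rV[R]_m]]
  else -oo%E.

Definition LD_feasible (x : 'rV[R]_n) (y : 'rV[R]_m) (u : 'rV[R]_p) : Prop :=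
  [/\ upper_set x, vec_le (g (row_mx x y)) 0, vec_le 0 u
    & ((f (row_mx x y))%:E <= psi_l x u)%E].

Definition chi (w : 'rV[R]_(n + m + p)) : \bar R :=
  ((f (lsubmx w))%:E - psi_l (lsubmx (lsubmx w)) (rsubmx w))%E.

Definition calF : set 'rV[R]_(n + m + p) :=
  [set w | vec_le (g (lsubmx w)) 0 /\ vec_le 0 (rsubmx w)].

Definition LD_index : finType := ('I_q + 'I_p + 'I_p + unit)%type.

Definition LD_system (c : LD_index) (w : 'rV[R]_(n + m + p)) : \bar R :=
  match c with
  | inl (inl (inl i)) => (G (lsubmx (lsubmx w)) 0 i)%:E
  | inl (inl (inr i)) => (g (lsubmx w) 0 i)%:E
  | inl (inr i) => (- rsubmx w 0 i)%:E
  | inr _ => chi w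
  end.

End LagrangeDualReformulation.

(* Main.v *)
Require Import Defs.
From HB Require Import structures.
From mathcomp Require Import all_boot all_order all_algebra.
From mathcomp Require Import all_classical all_reals all_analysis.
From mathcomp Require Import ring lra.

Import Order.TTheory GRing.Theory Num.Theory.
Import numFieldNormedType.Exports.

Local Open Scope classical_set_scope.
Local Open Scope ring_scope.
Set Implicit Arguments.
Unset Strict Implicit.
Unset Printing Implicit Defensive.

(** By weak duality chi is nonnegative on the set F of all (x, y, u) with
    g(x, y) <= 0 and u >= 0 ([chi_ge0]), and it vanishes at the feasible point
    w ([chi_feasible]). So w minimizes the lower semicontinuous function chi
    over F, and first-order conditions at a minimizer produce precisely the
    kind of nontrivial multiplier that NSMFCQ forbids.

    The conditions come from one Fritz John rule, [multiplier_rule]. If the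
    points (v, alpha) of a closed set E have alpha >= 0 whenever c(v) lies in a
    closed set Z, and (w, 0) is one of them, then there are mu normal to Z at
    c(w) and tau >= 0, not both zero, such that (- c'(w)^T mu, - tau) is normal
    to E at (w, 0).
    It is obtained by minimizing the height plus a quadratic penalty for the
    distance from c to Z and normalizing the multipliers, so that
    boundedness need not be known in advance: tau = 0 is the case in which
    they blow up. The rule is used twice.

    - With c the identity and Z = F, the case tau = 0 would give a nonzero
      element of the singular subdifferential of chi that is opposite to a
      normal of F, which the qualification excludes. Hence the limiting
      subdifferential of chi at w is nonempty. This is indispensable: NSMFCQ
      asks for an element of every subdifferential, also of those that
      receive the multiplier zero.
    - With c = g and Z the negative orthant, mu is nonnegative and
      complementary ([neg_orthant_normal]). If tau > 0, dividing by tau gives a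
      subgradient of chi, which receives the weight tau. If tau = 0, then zeta, the
      sum of the mu_j grad g_j, is a normal of F, and (- zeta, 0) is normal to
      the epigraph of chi; the qualification forces zeta = 0, so mu alone is a
      nontrivial multiplier vector, and the weight 0 on chi is attached to the
      subgradient from the first use.

    The multipliers of G and of - u are zero throughout; for u this is
    possible because chi is infinite where u >= 0 fails. Gradients of the
    smooth constraints belong to their limiting subdifferentials by
    [has_grad_limiting_subdiff].

    Normals are handled through Frechet normals: they are easy to read off
    from first-order expansions ([frechet_normal_local_max]), and limits of
    them are limiting normals ([limiting_normal_cone_frechet]). *)

(** * Inner product and norms on row vectors *)

Section InnerProduct.
Context {R : realType}.

Definition dot s (a b : 'rV[R]_s) : R := \sum_i a 0 i * b 0 i.

Lemma dotC s (a b : 'rV[R]_s) : dot a b = dot b a.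
Proof. by apply: eq_bigr => i _; rewrite mulrC. Qed.

Lemma dotDl s (a b c : 'rV[R]_s) : dot (a + b) c = dot a c + dot b c.
Proof.
by rewrite /dot -big_split; apply: eq_bigr => i _ /=; rewrite mxE mulrDl.
Qed.

Lemma dotZl s k (a b : 'rV[R]_s) : dot (k *: a) b = k * dot a b.
Proof. by rewrite /dot mulr_sumr; apply: eq_bigr => i _; rewrite mxE mulrA. Qed.

Lemma dotNl s (a b : 'rV[R]_s) : dot (- a) b = - dot a b.
Proof. by rewrite -scaleN1r dotZl mulN1r. Qed.

Lemma dotDr s (a b c : 'rV[R]_s) : dot a (b + c) = dot a b + dot a c.
Proof. by rewrite dotC dotDl !(dotC a). Qed.

Lemma dotZr s k (a b : 'rV[R]_s) : dot a (k *: b) = k * dot a b.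
Proof. by rewrite dotC dotZl dotC. Qed.

Lemma dotNr s (a b : 'rV[R]_s) : dot a (- b) = - dot a b.
Proof. by rewrite dotC dotNl dotC. Qed.

Lemma dot0l s (a : 'rV[R]_s) : dot 0 a = 0.
Proof. by rewrite /dot big1// => i _; rewrite mxE mul0r. Qed.

Lemma dot_delta s (a : 'rV[R]_s) i : dot (delta_mx 0 i) a = a 0 i.
Proof.
rewrite /dot (bigD1 i)//= big1 => [|j ji]; rewrite mxE eqxx ?eqxx/=.
  by rewrite mul1r addr0.
by rewrite (negbTE ji) mul0r.
Qed.

Lemma dot_row_mx s r (a c : 'rV[R]_s) (b d : 'rV[R]_r) :
  dot (row_mx a b) (row_mx c d) = dot a c + dot b d.
Proof.
rewrite /dot big_split_ord/=; congr (_ + _); apply: eq_bigr => i _.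
  by rewrite !row_mxEl.
by rewrite !row_mxEr.
Qed.

Lemma dot_ge0 s (a : 'rV[R]_s) : 0 <= dot a a.
Proof. by apply: sumr_ge0 => i _; rewrite -expr2 sqr_ge0. Qed.

Lemma enormE s (a : 'rV[R]_s) : enorm a = Num.sqrt (dot a a).
Proof. by congr Num.sqrt; apply: eq_bigr => i _; rewrite expr2. Qed.

Lemma dot_dist_le s (a b : 'rV[R]_s) :
  (enorm a <= enorm b) = (dot a a <= dot b b).
Proof. by rewrite !enormE ler_sqrt// dot_ge0. Qed.

Lemma norm_coord s (a : 'rV[R]_s) i : `|a 0 i| <= `|a|.
Proof.
rewrite [leRHS]/Num.Def.normr/= mx_normrE.
exact: (le_bigmax _ (fun ij : 'I_1 * 'I_s => `|a ij.1 ij.2|) (0, i)).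
Qed.

Lemma norm_le_coord s (a : 'rV[R]_s) e : 0 <= e ->
  (forall i, `|a 0 i| <= e) -> `|a| <= e.
Proof.
move=> e0 ae; rewrite [leLHS]/Num.Def.normr/= mx_normrE.
by apply: bigmax_le => // -[i j] _ /=; rewrite ord1.
Qed.

Lemma norm_coord_exists s (a : 'rV[R]_s) : a != 0 -> exists i, `|a| = `|a 0 i|.
Proof.
move=> a0; have [|[i j] /= aE] := @mx_norm_neq0 R 1 s a.
  by rewrite -[mx_norm _]/(`|a|) normr_eq0.
by exists j; rewrite -[LHS]/(mx_norm a) aE ord1.
Qed.

Lemma sqr_norm_le_dot s (a : 'rV[R]_s) : `|a| ^+ 2 <= dot a a.
Proof.
have [->|/norm_coord_exists[i ->]] := eqVneq a 0.
  by rewrite normr0 expr0n dot_ge0.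
rewrite /dot (bigD1 i)//= real_normK ?num_real// expr2 lerDl.
by apply: sumr_ge0 => j _; rewrite -expr2 sqr_ge0.
Qed.

Lemma dot_le_norm s (a b : 'rV[R]_s) : `|dot a b| <= s%:R * `|a| * `|b|.
Proof.
apply: le_trans (ler_norm_sum _ _ _) _.
apply: (@le_trans _ _ (\sum_(i < s) `|a| * `|b|)).
  by apply: ler_sum => i _; rewrite normrM ler_pM ?norm_coord.
by rewrite sumr_const card_ord -mulrA mulr_natl.
Qed.

Lemma norm_row_mx s r (a : 'rV[R]_s) (b : 'rV[R]_r) e :
  `|a| <= e -> `|b| <= e -> `|row_mx a b| <= e.
Proof.
move=> ae be; apply: norm_le_coord; first exact: le_trans (normr_ge0 a) ae.
move=> i; rewrite mxE; case: (fintype.split i) => j.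
  exact: le_trans (norm_coord _ _) ae.
exact: le_trans (norm_coord _ _) be.
Qed.

Lemma norm_scalar_mx1 (x : R) : `|x%:M : 'rV[R]_1| = `|x|.
Proof.
apply/le_anti/andP; split.
  by apply: norm_le_coord => // i; rewrite mxE ord1 eqxx.
by have := norm_coord (x%:M : 'rV[R]_1) 0; rewrite mxE eqxx.
Qed.

Lemma norm_lsubmx s r (v : 'rV[R]_(s + r)) : `|lsubmx v| <= `|v|.
Proof. by apply: norm_le_coord => // i; rewrite mxE norm_coord. Qed.

End InnerProduct.

(** * Continuity, closedness and compactness *)

Section Continuity.
Context {R : realType}.

Lemma continuous_sumr (T : topologicalType) (V : normedModType R) (I : finType)
    (F : I -> T -> V) :
  (forall i, continuous (F i)) -> continuous (fun x => \sum_i F i x).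
Proof.
move=> cF x.
have add_cont : continuous (fun z : V * V => z.1 + z.2) by exact: add_continuous.
exact: (@cvg_big V I +%R 0 xpredT add_cont T (nbhs x) _ F (F^~ x) _
  (fun i _ => cF i x)).
Qed.

Lemma continuous_fD (T : topologicalType) (V : normedModType R) (f g : T -> V) :
  continuous f -> continuous g -> continuous (fun x => f x + g x).
Proof. by move=> cf cg x; exact: (cvgD (cf x) (cg x)). Qed.

Lemma continuous_fB (T : topologicalType) (V : normedModType R) (f g : T -> V) :
  continuous f -> continuous g -> continuous (fun x => f x - g x).
Proof. by move=> cf cg x; exact: (cvgB (cf x) (cg x)). Qed.

Lemma continuous_fZ (T : topologicalType) (V : normedModType R)
    (k : T -> R) (f : T -> V) :
  continuous k -> continuous f -> continuous (fun x => k x *: f x).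
Proof. by move=> ck cf x; exact: (cvgZ (ck x) (cf x)). Qed.

Lemma continuous_coord (T : topologicalType) s (a : T -> 'rV[R]_s) i :
  continuous a -> continuous (fun x => a x 0 i).
Proof.
move=> ca x.
apply: (@cvg_comp _ _ _ a (fun v : 'rV[R]_s => v 0 i) _ _ _ (ca x)).
exact: coord_continuous.
Qed.

Lemma continuous_dot (T : topologicalType) s (a b : T -> 'rV[R]_s) :
  continuous a -> continuous b -> continuous (fun x => dot (a x) (b x)).
Proof.
move=> ca cb; apply: (@continuous_sumr T R^o) => i x.
by apply: cvgM; exact: continuous_coord.
Qed.

Lemma continuous_fcomp (T U V : topologicalType) (f : T -> U) (g : U -> V) :
  continuous f -> continuous g -> continuous (fun x => g (f x)).
Proof.
by move=> cf cg x; apply: (@continuous_comp _ _ _ f g); [exact: cf|exact: cg].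
Qed.

Lemma continuous_pr1 (T U : topologicalType) : continuous (fun x : T * U => x.1).
Proof. by move=> x; exact: cvg_fst. Qed.

Lemma continuous_pr2 (T U : topologicalType) : continuous (fun x : T * U => x.2).
Proof. by move=> x; exact: cvg_snd. Qed.

Lemma continuous_rowP (T : topologicalType) s (a : T -> 'rV[R]_s) :
  (forall i, continuous (fun x => a x 0 i)) -> continuous a.
Proof.
move=> ca x; apply/cvgrPdist_le => e e0.
have : \forall y \near x, forall i, `|a x 0 i - a y 0 i| <= e.
  apply: filter_forall => i.
  by have /cvgrPdist_le/(_ e e0) := ca i x.
apply: filterS => y ye; apply: norm_le_coord => [|i]; first exact: ltW.
by rewrite !mxE.
Qed.

Lemma continuous_row_mx (T : topologicalType) s r
    (a : T -> 'rV[R]_s) (b : T -> 'rV[R]_r) :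
  continuous a -> continuous b -> continuous (fun x => row_mx (a x) (b x)).
Proof.
move=> ca cb; apply: continuous_rowP => i.
case: (split_ordP i) => j ->.
  have -> : (fun x => row_mx (a x) (b x) 0 (lshift r j)) = (fun x => a x 0 j).
    by apply/funext => x; rewrite row_mxEl.
  exact: continuous_coord.
have -> : (fun x => row_mx (a x) (b x) 0 (rshift s j)) = (fun x => b x 0 j).
  by apply/funext => x; rewrite row_mxEr.
exact: continuous_coord.
Qed.

End Continuity.

Section Closedness.
Context {R : realType}.

Lemma closed_forall (T : topologicalType) (I : Type) (A : I -> set T) :
  (forall i, closed (A i)) -> closed [set x | forall i, A i x].
Proof.
move=> Acl; have -> : [set x | forall i, A i x] = \bigcap_(i in setT) A i.
  by apply/seteqP; split => x Ax i //; exact: Ax.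
exact: closed_bigI.
Qed.

Lemma closed_fle (T : topologicalType) (h k : T -> R) :
  continuous h -> continuous k -> closed [set x | h x <= k x].
Proof.
move=> ch ck; have -> : [set x | h x <= k x] = [set x | h x - k x <= 0].
  by apply/seteqP; split => x /=; rewrite subr_le0.
have chk := @continuous_fB _ _ R^o _ _ ch ck.
exact: (@closed_comp _ _ (fun x => h x - k x) [set y : R | y <= 0]
  (fun x _ => chk x)).
Qed.

Lemma closed_vec_le (T : topologicalType) s (a b : T -> 'rV[R]_s) :
  continuous a -> continuous b -> closed [set x | vec_le (a x) (b x)].
Proof.
move=> ca cb.
have -> : [set x | vec_le (a x) (b x)] = [set x | forall i, a x 0 i <= b x 0 i].
  by apply/seteqP; split => x /= /forallP.
by apply: closed_forall => i; apply: closed_fle; exact: continuous_coord.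
Qed.

Lemma compact_closed_ball s (A : set 'rV[R]_s) p e :
  closed A -> compact (A `&` [set v | `|v - p| <= e]).
Proof.
move=> Acl; apply: bounded_closed_compact.
  exists (`|p| + e); split; first exact: num_real.
  move=> M ltM v [_ /= ve]; apply: le_trans (ltW ltM).
  by rewrite -[v](subrK p) addrC (le_trans (ler_normD _ _))// lerD2l.
apply: closedI => //.
have cn : continuous (fun v : 'rV[R]_s => `|v - p|).
  move=> v; apply: (@cvg_norm _ _ _ (nbhs v) _ (fun v => v - p)).
  exact: (continuous_fB (fun v => cvg_id) (@cst_continuous _ _ p)).
exact: (@closed_comp _ _ _ [set y | y <= e] (fun x _ => cn x)).
Qed.

Lemma cluster_closed (T : topologicalType) (x : nat -> T) l (A : set T) N :
  cluster (x @ \oo) l -> closed A -> (forall k, (N <= k)%N -> A (x k)) -> A l.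
Proof.
move=> xl Acl xA; apply: Acl => U Ul.
by apply: (xl A U) => //; exists N.
Qed.

Lemma cluster_frequently (T : topologicalType) (x : nat -> T) l (U : set T) N :
  cluster (x @ \oo) l -> nbhs l U -> exists2 k, (N <= k)%N & U (x k).
Proof.
move=> xl Ul.
have tail : (x @ \oo) [set x k | k in [set k | (N <= k)%N]].
  by exists N => // k Nk; exists k.
have [y [[k Nk yE] Uk]] := xl _ _ tail Ul; exists k => //. by rewrite yE.
Qed.

End Closedness.

(** * Frechet normals *)

Section FrechetNormals.
Context {R : realType}.

Lemma proj_set_nonempty s (Om : set 'rV[R]_s) w :
  closed Om -> Om !=set0 -> proj_set Om w !=set0.
Proof.
move=> Omcl [v0 Omv0].
pose phi v := dot (w - v) (w - v).
have cphi : continuous phi.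
  have cw := continuous_fB (@cst_continuous _ _ w) (fun v => cvg_id).
  exact: (continuous_dot cw cw).
pose A := Om `&` [set v | phi v <= phi v0].
have cA : compact A.
  apply: bounded_closed_compact.
    exists (`|w| + (phi v0 + 1)); split; first exact: num_real.
    move=> M ltM v [_ /= phile]; apply: le_trans (ltW ltM).
    have : `|w - v| <= phi v0 + 1.
      have := le_trans (sqr_norm_le_dot (w - v)) phile.
      by have := normr_ge0 (w - v); have : 0 <= phi v0 := dot_ge0 _; nra.
    have := ler_normB w (w - v); rewrite subKr; lra.
  apply: closedI => //.
  exact: (@closed_comp _ _ phi [set y | y <= phi v0] (fun x _ => cphi x)).
have [|v /set_mem[Omv _] vmin] := compact_EVT_min _ cA (continuous_subspaceT cphi).
  by exists v0; split => /=.
exists v; split => // v' Omv'; rewrite dot_dist_le.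
have [v'le|/ltW] := leP (phi v') (phi v0); first by apply: vmin; exact/mem_set.
by apply: le_trans; apply: vmin; apply/mem_set; split => /=.
Qed.

(** The sup norm may stand for the Euclidean norm in this definition, the two
    being equivalent; only nearest points depend on the choice. *)
Definition frechet_normal s (Om : set 'rV[R]_s) (p : 'rV[R]_s) :
    set 'rV[R]_s :=
  [set a | forall e : R, 0 < e ->
     \forall v \near p, Om v -> dot a (v - p) <= e * `|v - p|].

(** Project p + t a for small t > 0. The projection v is at least as close as
    p, so |v - p|^2 <= 2 t <a, v - p>, which is t o(|v - p|) for a Frechet
    normal a. Hence v - p = o(t), and (p + t a - v) / t is close to a. *)
Lemma frechet_normal_projection s (Om : set 'rV[R]_s) p a (e : R) :
    closed Om -> Om p -> frechet_normal Om p a -> 0 < e ->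
  exists w v t, [/\ proj_set Om w v, 0 < t, `|w - p| <= e
    & `|t *: (w - v) - a| <= e].
Proof.
move=> Omcl Omp pa e0.
have e20 : 0 < e / 2 by rewrite divr_gt0.
have /nbhs_ballP[r /= r0 hr] := pa _ e20.
pose D := dot a a.
have D0 : 0 <= D := dot_ge0 _.
(* t M is small: then t |a|, the distance from p to the projected point, and
   2 t sqrt D, an a priori bound of |v - p|, are both small *)
pose M := `|a| + 2 * (D + 1) + 1.
have M0 : 0 < M by rewrite /M; have := normr_ge0 a; lra.
have er0 : 0 < Num.min e r by rewrite lt_min e0 r0.
have [t t0 tM] : exists2 t, 0 < t & t * M = Num.min e r.
  exists (Num.min e r / M); first by rewrite divr_gt0.
  by rewrite mulrVK// unitfE gt_eqF.
have tMe : t * M <= e by rewrite tM ge_min lexx.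
have tMr : t * M <= r by rewrite tM ge_min lexx orbT.
have ta0 : 0 <= t * `|a| by rewrite mulr_ge0// ltW.
have tD0 : 0 <= t * D by rewrite mulr_ge0// ltW.
have [v [Omv vmin]] := proj_set_nonempty (p + t *: a) Omcl (ex_intro _ p Omp).
have [d dE] : exists d, d = v - p by exists (v - p).
have Hd : dot d d <= 2 * t * dot a d.
  have := vmin _ Omp; rewrite dot_dist_le.
  have -> : p + t *: a - v = t *: a - d by rewrite dE opprB addrCA addrA.
  have -> : p + t *: a - p = t *: a by rewrite addrAC subrr add0r.
  rewrite !(dotDl, dotDr, dotNl, dotNr, dotZl, dotZr) (dotC d a).
  by lra.
have Hd4 : dot d d <= 4 * t ^+ 2 * D.
  have := dot_ge0 (d - (2 * t) *: a).
  rewrite !(dotDl, dotDr, dotNl, dotNr, dotZl, dotZr) (dotC d a) -/D.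
  by nra.
have dr : `|d| < r.
  apply: lt_le_trans tMr.
  have : `|d| ^+ 2 <= 4 * t ^+ 2 * D := le_trans (sqr_norm_le_dot d) Hd4.
  have : 4 * t ^+ 2 * D < (t * M) ^+ 2.
    have h4 : D * 4 < M ^+ 2 by rewrite /M; have := normr_ge0 a; nra.
    have -> : 4 * t ^+ 2 * D = t ^+ 2 * (D * 4) by ring.
    by rewrite exprMn ltr_pM2l ?exprn_gt0.
  move=> h1 h2; rewrite -(@ltr_pXn2r _ 2)// ?nnegrE ?normr_ge0 ?mulr_ge0 ?ltW//.
  exact: le_lt_trans h2 h1.
have ade : dot a d <= e / 2 * `|d|.
  by rewrite dE; apply: hr => //; rewrite -ball_normE /= distrC -dE.
have dte : `|d| <= t * e.
  have h : `|d| ^+ 2 <= t * e * `|d|.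
    apply: le_trans (sqr_norm_le_dot d) _; apply: le_trans Hd _.
    have := ler_wpM2l (ltW t0) ade; by lra.
  have [d0|d0] := eqVneq `|d| 0; first by rewrite d0 mulr_ge0// ltW.
  by move: h; rewrite expr2 ler_pM2r// lt_def d0 normr_ge0.
exists (p + t *: a), v, t^-1; split => //.
- by rewrite invr_gt0.
- rewrite addrAC subrr add0r normrZ gtr0_norm//; apply: le_trans tMe.
  by rewrite /M; nra.
- have -> : t^-1 *: (p + t *: a - v) - a = - (t^-1 *: d).
    rewrite dE -scalerN opprB addrAC scalerDr scalerA mulVf ?gt_eqF//.
    by rewrite scale1r addrK.
  by rewrite normrN normrZ gtr0_norm ?invr_gt0// ler_pdivrMl.
Qed.

(** The k-th projection is chosen for a Frechet normal within 1 / (k + 1) of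
    eta. This spares diagonal sequences elsewhere: approximating normals only
    have to exist for each tolerance, and need not be proximal. *)
Lemma limiting_normal_cone_frechet s (Om : set 'rV[R]_s) w eta :
    closed Om ->
    (forall e, 0 < e -> exists p a, [/\ Om p, frechet_normal Om p a,
       `|p - w| <= e & `|a - eta| <= e]) ->
  limiting_normal_cone Om w eta.
Proof.
move=> Omcl H.
have S k : exists x : 'rV[R]_s * 'rV[R]_s * R,
    [/\ proj_set Om x.1.1 x.1.2, 0 < x.2, `|x.1.1 - w| <= 2 * k.+1%:R^-1
      & `|x.2 *: (x.1.1 - x.1.2) - eta| <= 2 * k.+1%:R^-1].
  have k0 : 0 < k.+1%:R^-1 :> R by rewrite invr_gt0 ltr0n.
  have [p [a [Omp pa pw aeta]]] := H _ k0.
  have [u [v [t [uv t0 up ua]]]] := frechet_normal_projection Omcl Omp pa k0.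
  exists (u, v, t); split => //=.
    rewrite -(subrKA p); apply: le_trans (ler_normD _ _) _.
    by rewrite mulr2n mulrDl mul1r lerD.
  rewrite -(subrKA a); apply: le_trans (ler_normD _ _) _.
  by rewrite mulr2n mulrDl mul1r lerD.
have lim0 (x : nat -> 'rV[R]_s) l :
    (forall k, `|x k - l| <= 2 * k.+1%:R^-1) -> x @ \oo --> l.
  move=> xl; apply/cvgrPdist_le => e e0.
  have e20 : 0 < e / 2 by rewrite divr_gt0.
  have := @near_infty_natSinv_lt R (PosNum e20).
  apply: filterS => k /= ke; rewrite distrC (le_trans (xl k))//.
  by rewrite mulrC -ler_pdivlMr// ltW.
have [x Hx] := choice S.
exists (fun k => (x k).1.1), (fun k => (x k).1.2), (fun k => (x k).2); split.
- by apply: lim0 => k; have [] := Hx k.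
- by move=> k; have [] := Hx k.
- by move=> k; have [] := Hx k.
- by apply: lim0 => k; have [] := Hx k.
Qed.

Lemma frechet_limiting s (Om : set 'rV[R]_s) w eta :
    closed Om -> Om w -> frechet_normal Om w eta ->
  limiting_normal_cone Om w eta.
Proof.
move=> Omcl Omw weta; apply: limiting_normal_cone_frechet => // e e0.
by exists w, eta; rewrite !subrr !normr0 ltW.
Qed.

Lemma frechet_normalZ s (Om : set 'rV[R]_s) w eta k : 0 < k ->
  frechet_normal Om w eta -> frechet_normal Om w (k *: eta).
Proof.
move=> k0 h e e0; have := h _ (divr_gt0 e0 k0).
apply: filterS => v /[apply]; rewrite dotZl -mulrA mulrCA.
by rewrite ler_pdivlMl.
Qed.

Lemma limiting_normal_coneZ s (Om : set 'rV[R]_s) w eta k : 0 < k ->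
  limiting_normal_cone Om w eta -> limiting_normal_cone Om w (k *: eta).
Proof.
move=> k0 [wk [vk [al [wkw vkP al0 aleta]]]].
exists wk, vk, (fun i => k * al i); split => //.
  by move=> i; rewrite mulr_gt0.
rewrite [X in X @ _](_ : _ = fun i => k *: (al i *: (wk i - vk i))).
  by apply: cvgZl_tmp.
by apply/funext => i; rewrite scalerA.
Qed.

End FrechetNormals.

(** * First-order expansions *)

Section Gradients.
Context {R : realType}.

(** Stated with an explicit tolerance, so that sums, squares and compositions
    reduce to elementary estimates. *)
Definition has_grad s (h : 'rV[R]_s -> R) (p a : 'rV[R]_s) : Prop :=
  forall e : R, 0 < e -> \forall v \near p,
    `|h v - h p - dot a (v - p)| <= e * `|v - p|.

Lemma differentiable_has_grad s (h : 'rV[R]_s -> R) p :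
  differentiable h p -> has_grad h p (grad h p).
Proof.
move=> dh e e0.
have [[_ /eqaddoP/(_ e e0)]] := dh.
apply: filterS => v /=; rewrite lim_id// => H.
suff -> : dot (grad h p) (v - p) = 'd h p (v - p).
  by apply: le_trans H; rewrite opprD addrA.
set d := v - p.
rewrite [in RHS](row_sum_delta d) linear_sum/=.
by apply: eq_bigr => i _; rewrite linearZ/= mxE deriveE// mulrC.
Qed.

Lemma has_grad_dot s (b p : 'rV[R]_s) : has_grad (dot b) p b.
Proof.
move=> e e0; apply: (@nearW _ (nbhs p)) => v.
by rewrite dotDr dotNr subrr normr0 mulr_ge0// ltW.
Qed.

Lemma has_gradD s (h k : 'rV[R]_s -> R) p a b : has_grad h p a ->
  has_grad k p b -> has_grad (fun v => h v + k v) p (a + b).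
Proof.
move=> ha kb e e0; have e20 : 0 < e / 2 by rewrite divr_gt0.
apply: filterS2 (ha _ e20) (kb _ e20) => v h1 h2.
rewrite dotDl.
have -> : h v + k v - (h p + k p) - (dot a (v - p) + dot b (v - p)) =
  (h v - h p - dot a (v - p)) + (k v - k p - dot b (v - p)) by ring.
by apply: le_trans (ler_normD _ _) _; rewrite (splitr e) [leRHS]mulrDl lerD.
Qed.

Lemma has_gradDc s (h : 'rV[R]_s -> R) p a c : has_grad h p a ->
  has_grad (fun v => h v + c) p a.
Proof.
move=> ha e e0; apply: filterS (ha _ e0) => v.
by have -> : h v + c - (h p + c) = h v - h p by ring.
Qed.

Lemma has_gradZ s (h : 'rV[R]_s -> R) p a c : has_grad h p a ->
  has_grad (fun v => c * h v) p (c *: a).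
Proof.
move=> ha e e0.
have c0 : 0 < `|c| + 1 by have := normr_ge0 c; lra.
have := ha _ (divr_gt0 e0 c0); apply: filterS => v H.
have -> : c * h v - c * h p - dot (c *: a) (v - p) =
  c * (h v - h p - dot a (v - p)) by rewrite dotZl; ring.
rewrite normrM; apply: (@le_trans _ _ (`|c| * (e / (`|c| + 1) * `|v - p|))).
  exact: ler_wpM2l.
rewrite mulrA ler_wpM2r// mulrCA ger_pMr// ler_pdivrMr// mul1r; lra.
Qed.

Lemma has_grad_sum s r (h : 'I_r -> 'rV[R]_s -> R) p a :
  (forall i, has_grad (h i) p (a i)) ->
  has_grad (fun v => \sum_i h i v) p (\sum_i a i).
Proof.
move=> ha; elim: r h a ha => [|r IH] h a ha.
  move=> e e0; apply: (@nearW _ (nbhs p)) => v.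
  by rewrite !big_ord0 dot0l subrr subr0 normr0 mulr_ge0// ltW.
have -> : (fun v => \sum_i h i v) =
    (fun v => h ord0 v + \sum_i h (lift ord0 i) v).
  by apply/funext => v; rewrite big_ord_recl.
by rewrite big_ord_recl; apply: has_gradD => //; apply: IH => i.
Qed.

Lemma near_norm_le s (p : 'rV[R]_s) e : 0 < e -> \forall v \near p, `|v - p| <= e.
Proof.
move=> e0; apply: filterS (nbhsx_ballx p _ e0) => v.
by rewrite -ball_normE /= distrC => /ltW.
Qed.

Lemma has_grad_sqr s (h : 'rV[R]_s -> R) p a : has_grad h p a ->
  has_grad (fun v => h v ^+ 2) p ((2 * h p) *: a).
Proof.
move=> ha e e0.
pose C := 1 + s%:R * `|a|.
have C1 : 1 <= C by rewrite /C lerDl mulr_ge0.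
have C2 : 0 < 2 * C ^+ 2 by rewrite mulr_gt0// exprn_gt0//; lra.
have h2 : 0 < 4 * (`|h p| + 1) by have := normr_ge0 (h p); lra.
near=> v.
have H1 : `|h v - h p - dot a (v - p)| <= 1 * `|v - p|.
  by near: v; apply: ha.
have H2 : `|h v - h p - dot a (v - p)| <= e / (4 * (`|h p| + 1)) * `|v - p|.
  by near: v; apply: ha; rewrite divr_gt0.
have H3 : `|v - p| <= e / (2 * C ^+ 2).
  by near: v; apply: near_norm_le; rewrite divr_gt0.
have H4 : `|h v - h p| <= C * `|v - p|.
  rewrite -[h v - h p](subrK (dot a (v - p))) /C mulrDl.
  by apply: le_trans (ler_normD _ _) _; apply: lerD => //; exact: dot_le_norm.
rewrite dotZl.
have -> : h v ^+ 2 - h p ^+ 2 - 2 * h p * dot a (v - p) =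
  2 * h p * (h v - h p - dot a (v - p)) + (h v - h p) ^+ 2 by ring.
apply: le_trans (ler_normD _ _) _; rewrite (splitr e) [leRHS]mulrDl; apply: lerD.
  rewrite normrM normrM ger0_norm//.
  apply: (@le_trans _ _ (2 * `|h p| * (e / (4 * (`|h p| + 1)) * `|v - p|))).
    by apply: ler_wpM2l => //; rewrite mulr_ge0.
  rewrite mulrA ler_wpM2r// mulrA ler_pdivrMr//.
  by have := normr_ge0 (h p); nra.
rewrite normrX; apply: (@le_trans _ _ ((C * `|v - p|) ^+ 2)).
  by rewrite ler_sqr ?nnegrE ?mulr_ge0//; lra.
rewrite exprMn [`|v - p| ^+ 2]expr2 mulrA ler_wpM2r//.
move: H3; rewrite ler_pdivlMr//; lra.
Unshelve. all: by end_near. Qed.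

Lemma has_grad_sqdist s (b p : 'rV[R]_s) :
  has_grad (fun v => dot (v - b) (v - b)) p (2 *: (p - b)).
Proof.
move=> e e0.
have s0 : 0 < s%:R + 1 :> R by have := ler0n R s; lra.
near=> v.
have H : `|v - p| <= e / (s%:R + 1).
  by near: v; apply: near_norm_le; rewrite divr_gt0.
have -> : v - b = (v - p) + (p - b) by rewrite addrA subrK.
have -> : dot (v - p + (p - b)) (v - p + (p - b)) - dot (p - b) (p - b)
    - dot (2 *: (p - b)) (v - p) = dot (v - p) (v - p).
  by move: (v - p) (p - b) => x y; rewrite !(dotDl, dotDr, dotZl) (dotC y x); ring.
apply: le_trans (dot_le_norm _ _) _; rewrite ler_wpM2r//.
move: H; rewrite ler_pdivlMr//; have := normr_ge0 (v - p); nra.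
Unshelve. all: by end_near. Qed.

Lemma has_grad_lsubmx s r (h : 'rV[R]_s -> R) (p : 'rV[R]_(s + r)) a :
  has_grad h (lsubmx p) a -> has_grad (fun v => h (lsubmx v)) p (row_mx a 0).
Proof.
move=> ha e e0; have := ha _ e0.
move=> /(@continuous_lsubmx R 1 s r p _); apply: (@filterS _ (nbhs p)) => v /= H.
rewrite -[v - p]hsubmxK dot_row_mx dot0l addr0 hsubmxK raddfB/=.
by apply: le_trans H _; rewrite ler_wpM2l ?(ltW e0)// -raddfB norm_lsubmx.
Qed.

(** The coordinate of the real factor when row vectors of size s + 1 are read
    as points of an epigraph. *)
Definition height s (e : 'rV[R]_(s + 1)) : R := rsubmx e 0 0.

Lemma continuous_height s : continuous (@height s).
Proof. exact/continuous_coord/continuous_rsubmx. Qed.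

Lemma has_grad_height s (p : 'rV[R]_(s + 1)) :
  has_grad (@height s) p (row_mx 0 1%:M).
Proof.
have -> : @height s = dot (row_mx 0 1%:M).
  apply/funext => e; rewrite -[e in RHS]hsubmxK dot_row_mx dot0l add0r /dot.
  by rewrite big_ord1 mxE eqxx mul1r.
exact: has_grad_dot.
Qed.

(** All Frechet normals below come from this lemma. At a minimizer, h is the
    opposite of a penalized objective; for epigraphs and sublevel sets, h is a
    function that is nonpositive on the set and vanishes at p. *)
Lemma frechet_normal_local_max s (Om : set 'rV[R]_s) (h : 'rV[R]_s -> R) p a :
    has_grad h p a -> (\forall v \near p, Om v -> h v <= h p) ->
  frechet_normal Om p a.
Proof.
move=> ha hmax e e0; apply: filterS2 (ha _ e0) hmax => v H1 /[apply] H2.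
move: H1; rewrite ler_norml => /andP[H1 _]; lra.
Qed.

End Gradients.

(** * A multiplier rule for minimizing a height over an epigraph *)

Section MultiplierRule.
Context {R : realType}.

Lemma frechet_normal_nearest s (Z : set 'rV[R]_s) (a q : 'rV[R]_s) k : 0 < k ->
    (\forall z \near q, Z z -> dot (a - q) (a - q) <= dot (a - z) (a - z)) ->
  frechet_normal Z q (k *: (a - q)).
Proof.
move=> k0 qmin; have -> : k *: (a - q) = (- (k / 2)) *: (2 *: (q - a)).
  by rewrite scalerA mulNr mulfVK ?pnatr_eq0// scaleNr -scalerN opprB.
apply: frechet_normal_local_max (has_gradZ _ (has_grad_sqdist a q)) _.
apply: filterS qmin => z /[apply].
have sq y : dot (y - a) (y - a) = dot (a - y) (a - y).
  by rewrite -[y - a]opprB dotNl dotNr opprK.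
by rewrite !sq !mulNr lerN2 ler_pM2l ?divr_gt0.
Qed.

Section Penalty.
Context {s r : nat}.
Variables (c : 'rV[R]_s -> 'rV[R]_r) (J : 'I_r -> 'rV[R]_s -> 'rV[R]_s).
Hypothesis c_grad : forall j w, has_grad (fun v => c v 0 j) w (J j w).
Variable wb : 'rV[R]_s.

(** The point z ranges over the set that c should meet; keeping it as a
    variable, instead of taking the distance from c to that set, leaves an
    objective that is differentiable in each variable. The last term singles
    out wb among the minimizers of the limit problem. *)
Definition penalized k (e : 'rV[R]_(s + 1)) (z : 'rV[R]_r) : R :=
  height e + k / 2 * dot (c (lsubmx e) - z) (c (lsubmx e) - z)
  + 1 / 2 * dot (lsubmx e - wb) (lsubmx e - wb).

Lemma frechet_normal_penalized (E : set 'rV[R]_(s + 1)) k z p :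
    (\forall e \near p, E e -> penalized k p z <= penalized k e z) ->
  frechet_normal E p (row_mx
    (- (\sum_j (k *: (c (lsubmx p) - z)) 0 j *: J j (lsubmx p)
        + (lsubmx p - wb))) (- 1)%:M).
Proof.
move=> pmin; set w := lsubmx p.
pose psi v := k / 2 * (\sum_j (c v 0 j - z 0 j) ^+ 2)
  + 1 / 2 * dot (v - wb) (v - wb).
have gpsi : has_grad psi w
    (\sum_j (k *: (c w - z)) 0 j *: J j w + (w - wb)).
  have -> : \sum_j (k *: (c w - z)) 0 j *: J j w + (w - wb) =
      (k / 2) *: (\sum_j (2 * (c w 0 j - z 0 j)) *: J j w)
      + (1 / 2) *: (2 *: (w - wb)).
    rewrite scalerA mulfVK ?pnatr_eq0// scale1r scaler_sumr; congr (_ + _).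
    by apply: eq_bigr => j _; rewrite scalerA mulrA mulfVK ?pnatr_eq0// !mxE.
  apply: has_gradD; last by apply: has_gradZ; exact: has_grad_sqdist.
  apply: has_gradZ; apply: has_grad_sum => j.
  exact: (has_grad_sqr (has_gradDc (- z 0 j) (@c_grad j w))).
have psiE e : penalized k e z = psi (lsubmx e) + height e.
  rewrite /penalized /psi addrAC [RHS]addrC addrA addrAC; congr (_ + _ + _).
  congr (_ * _).
  by apply: eq_bigr => j _; rewrite !mxE expr2.
have := has_gradZ (-1) (has_gradD (has_grad_lsubmx gpsi) (has_grad_height p)).
rewrite scaleN1r add_row_mx addr0 add0r opp_row_mx -raddfN.
move/frechet_normal_local_max; apply.
apply: filterS pmin => e /[apply]; rewrite -!psiE; lra.
Qed.

End Penalty.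

(** Minimize [penalized] with weight k + 1 over E and Z within unit balls. The
    penalty stays bounded, so it forces c(w) = z at every cluster point of the
    minimizers, where the height is then nonnegative by hypothesis and
    nonpositive by comparison with wb: the cluster point is (wb, 0), c(wb).
    Near it the balls are inactive and each minimizer yields Frechet normals
    to E and to Z that share the multiplier lam. Scaled by 1 / (1 + |lam|),
    these stay in a compact set, and a cluster point gives mu and tau with
    |mu| + tau = 1. *)
Lemma multiplier_rule s r (E : set 'rV[R]_(s + 1)) (Z : set 'rV[R]_r)
    (c : 'rV[R]_s -> 'rV[R]_r) (J : 'I_r -> 'rV[R]_s -> 'rV[R]_s) wb :
    closed E -> closed Z -> continuous c -> (forall j, continuous (J j)) ->
    (forall j w, has_grad (fun v => c v 0 j) w (J j w)) ->
    E (row_mx wb 0%:M) -> Z (c wb) ->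
    (forall e, E e -> Z (c (lsubmx e)) -> 0 <= height e) ->
  exists mu tau, [/\ 0 <= tau, tau = 0 -> mu != 0,
    limiting_normal_cone Z (c wb) mu
    & limiting_normal_cone E (row_mx wb 0%:M)
        (row_mx (- \sum_j mu 0 j *: J j wb) (- tau)%:M)].
Proof.
move=> Ecl Zcl cc cJ cgrad Ewb Zwb Emin.
pose e0 : 'rV[R]_(s + 1) := row_mx wb 0%:M.
pose K1 := E `&` [set e | `|e - e0| <= 1].
pose K2 := Z `&` [set z | `|z - c wb| <= 1].
have cK : compact (K1 `*` K2) by apply: compact_setX; exact: compact_closed_ball.
have K0 : (K1 `*` K2) (e0, c wb).
  by split; split => //=; rewrite subrr normr0.
have le0 : lsubmx e0 = wb by rewrite row_mxKl.
have he0 : height e0 = 0 by rewrite /height row_mxKr mxE eqxx.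
pose Phi k (x : 'rV[R]_(s + 1) * 'rV[R]_r) := penalized c wb k.+1%:R x.1 x.2.
have cls : continuous (fun x : 'rV[R]_(s + 1) * 'rV[R]_r => lsubmx x.1).
  exact: (continuous_fcomp (@continuous_pr1 _ _) (@continuous_lsubmx _ _ _ _)).
have cgap : continuous (fun x : 'rV[R]_(s + 1) * 'rV[R]_r =>
    c (lsubmx x.1) - x.2).
  exact: continuous_fB (continuous_fcomp cls cc) (@continuous_pr2 _ _).
have chx : continuous (fun x : 'rV[R]_(s + 1) * 'rV[R]_r => height x.1).
  exact: (continuous_fcomp (@continuous_pr1 _ _) (@continuous_height _ _)).
have cdx : continuous (fun x : 'rV[R]_(s + 1) * 'rV[R]_r => lsubmx x.1 - wb).
  exact: continuous_fB cls (@cst_continuous _ _ wb).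
have cZ k (h : 'rV[R]_(s + 1) * 'rV[R]_r -> R) :
    continuous h -> continuous (fun x => k * h x).
  exact: (@continuous_fZ _ _ R^o (cst k) h (@cst_continuous _ _ k)).
have cPhi k : continuous (Phi k).
  apply: (@continuous_fD _ _ R^o); last exact/cZ/continuous_dot.
  by apply: (@continuous_fD _ _ R^o) => //; exact/cZ/continuous_dot.
have minP k : exists x, (K1 `*` K2) x /\
    forall y, (K1 `*` K2) y -> Phi k x <= Phi k y.
  have [|x /set_mem Kx xmin] :=
    compact_EVT_min _ cK (continuous_subspaceT (cPhi k)).
    by exists (e0, c wb).
  by exists x; split => // y Ky; apply: xmin; exact/mem_set.
have [x Hx] := choice minP.
pose lam k := k.+1%:R *: (c (lsubmx (x k).1) - (x k).2).
pose t k : R := (1 + `|lam k|)^-1.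
have lam1 k : 0 < 1 + `|lam k| by have := normr_ge0 (lam k); lra.
have t0 k : 0 < t k by rewrite invr_gt0.
have tlam k : `|t k *: lam k| + t k = 1.
  rewrite normrZ gtr0_norm// -{2}[t k]mulr1 -mulrDr [_ + 1]addrC.
  by rewrite mulVf// gt_eqF.
pose X k : ('rV[R]_(s + 1) * 'rV[R]_r) * ('rV[R]_r * R) :=
  (x k, (t k *: lam k, t k)).
pose S := (K1 `*` K2) `*`
  (([set: 'rV[R]_r] `&` [set v | `|v - 0| <= 1]) `*` (`[0, 1]%classic : set R)).
have cS : compact S.
  apply: compact_setX => //; apply: compact_setX; last exact: segment_compact.
  by apply: compact_closed_ball; exact: closedT.
have SX k : S (X k).
  split; first by have [] := Hx k.
  have := tlam k; have := normr_ge0 (t k *: lam k); have := t0 k => h1 h2 h3.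
  split => /=; first by split => //=; rewrite subr0; lra.
  by rewrite in_itv/=; apply/andP; split; lra.
have [/=|[[es zs] [mu tau]] [[[/= [Ees _] [Zzs _]] _] Xcl]] := cS (X @ \oo) _.
  by exists 0%N => // k _; exact: SX.
pose l := ((es, zs), (mu, tau)) : ('rV[R]_(s + 1) * 'rV[R]_r) * ('rV[R]_r * R).
have lim_le (h : _ -> R) b N : continuous h ->
    (forall k, (N <= k)%N -> h (X k) <= b) -> h l <= b.
  move=> ch; apply: (@cluster_closed _ X l [set y | h y <= b] N Xcl).
  exact: (@closed_comp _ _ h [set y | y <= b] (fun y _ => ch y)).
have near_le (V : normedModType R) (h : _ -> V) b : continuous h -> 0 < b ->
    \forall y \near l, `|h y - h l| <= b.
  move=> ch b0; have /cvgrPdist_le/(_ b b0) := ch l.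
  by apply: filterS => y; rewrite distrC.
have cy1 : continuous (fun y :
    ('rV[R]_(s + 1) * 'rV[R]_r) * ('rV[R]_r * R) => y.1).
  exact: continuous_pr1.
have cy2 : continuous (fun y :
    ('rV[R]_(s + 1) * 'rV[R]_r) * ('rV[R]_r * R) => y.2).
  exact: continuous_pr2.
have cy11 := continuous_fcomp cy1 (@continuous_pr1 _ _).
have cy12 := continuous_fcomp cy1 (@continuous_pr2 _ _).
have cy21 := continuous_fcomp cy2 (@continuous_pr1 _ _).
have cy22 := continuous_fcomp cy2 (@continuous_pr2 _ _).
have Phi0 k : Phi k (x k) <= 0.
  have [_ /(_ _ K0)] := Hx k; rewrite {2}/Phi /penalized /= le0 he0 !subrr.
  by rewrite !dot0l !mulr0 !addr0.
have gap0 k : 0 <= k.+1%:R / 2 * dot (c (lsubmx (x k).1) - (x k).2)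
                                   (c (lsubmx (x k).1) - (x k).2).
  by rewrite mulr_ge0 ?dot_ge0// divr_ge0.
have dist0 (e : 'rV[R]_(s + 1)) :
    0 <= 1 / 2 * dot (lsubmx e - wb) (lsubmx e - wb).
  by rewrite mulr_ge0 ?dot_ge0// divr_ge0.
(* every value of the penalized objective is at most its value 0 at wb *)
have low : height es + 1 / 2 * dot (lsubmx es - wb) (lsubmx es - wb) <= 0.
  apply: (lim_le (fun y => height y.1.1
    + 1 / 2 * dot (lsubmx y.1.1 - wb) (lsubmx y.1.1 - wb)) 0 0%N).
    have cl := @continuous_fD _ _ R^o _ _ chx
      (cZ (1 / 2) _ (continuous_dot cdx cdx)).
    exact: continuous_fcomp cy1 cl.
  move=> k _ /=; have := Phi0 k; have := gap0 k; rewrite /Phi /penalized; lra.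
have gapc : c (lsubmx es) = zs.
  apply/eqP; rewrite -subr_eq0 -normr_eq0 -sqrf_eq0 eq_le sqr_ge0 andbT.
  apply: le_trans (sqr_norm_le_dot _) _; apply/ler_addgt0Pr => e epos.
  have e20 : 0 < e / 2 by rewrite divr_gt0.
  have [N _ HN] := @near_infty_natSinv_lt R (PosNum e20).
  apply: (lim_le (fun y => dot (c (lsubmx y.1.1) - y.1.2)
    (c (lsubmx y.1.1) - y.1.2)) _ N).
    exact: (continuous_fcomp cy1 (continuous_dot cgap cgap)).
  move=> k Nk /=; rewrite add0r; have /= ke := HN k Nk.
  (* the unit ball bounds the height from below, hence the penalty from
     above by 2 / (k + 1) after division by half its weight *)
  have hge : - 1 <= height (x k).1.
    have [[[_ /= d1] _] _] := Hx k.
    have := le_trans (norm_coord _ (rshift s 0)) d1.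
    have -> : ((x k).1 - e0) 0 (rshift s 0) = height (x k).1 - height e0.
      by rewrite /height !mxE.
    by rewrite he0 subr0 ler_norml => /andP[].
  have := Phi0 k; have := dist0 (x k).1; rewrite /Phi /penalized.
  move: (dot (c _ - _) _) (dot (lsubmx _ - _) _) => A B h1 h2.
  have k0 : 0 < k.+1%:R :> R by rewrite ltr0n.
  have kA : k.+1%:R * A <= 2 by move: (k.+1%:R : R) h2 => K h2; nra.
  have : A <= k.+1%:R^-1 * 2 by rewrite ler_pdivlMl.
  by move: ke; move: (k.+1%:R^-1 : R) => K ke; lra.
have hes0 : 0 <= height es by apply: Emin => //; rewrite gapc.
have les : lsubmx es = wb.
  apply/eqP; rewrite -subr_eq0 -normr_eq0 -sqrf_eq0 eq_le sqr_ge0 andbT.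
  by apply: le_trans (sqr_norm_le_dot _) _; lra.
have hes : height es = 0 by have := dist0 es; lra.
have esE : es = e0.
  rewrite -[es]hsubmxK les; congr row_mx; apply/matrixP => i j.
  by rewrite !ord1 [LHS]hes mxE eqxx.
have zsE : zs = c wb by rewrite -gapc les.
have tau0 : 0 <= tau.
  rewrite -oppr_le0; apply: (lim_le (fun y => - y.2.2) 0 0%N).
    by move=> y; apply: cvgN; exact: cy22.
  by move=> k _ /=; rewrite oppr_le0 ltW.
have le_mutau : 1 <= `|mu| + tau.
  rewrite -lerN2; apply: (lim_le (fun y => - (`|y.2.1| + y.2.2)) _ 0%N).
    move=> y; apply: cvgN; apply: cvgD; last exact: cy22.
    by apply: cvg_norm; exact: cy21.
  by move=> k _ /=; rewrite tlam.
(* a minimizer within 1/2 of the centre of the unit ball is a minimizer over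
   its own ball of radius 1/2 *)
have d12 : 0 < 1 / 2 :> R by rewrite divr_gt0.
exists mu, tau; split => //.
- move=> tau00; apply/eqP => mu00; move: le_mutau.
  by rewrite tau00 mu00 normr0 addr0 ler10.
- apply: limiting_normal_cone_frechet => // e epos.
  have [k _ [[d1 d2] d3]] := cluster_frequently 0%N Xcl
    (filterI (filterI (near_le _ _ _ cy12 d12) (near_le _ _ _ cy12 epos))
       (near_le _ _ _ cy21 epos)).
  have [[_ [Zk _]] kmin] := Hx k.
  exists (x k).2, (t k *: lam k); split => //; last by rewrite -zsE.
  apply: frechet_normalZ => //; apply: frechet_normal_nearest => //.
  apply: filterS (near_norm_le (x k).2 d12) => z zk Zz.
  have /kmin : (K1 `*` K2) ((x k).1, z).
    split; first by have [[]] := Hx k.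
    split => //=; rewrite -(subrKA (x k).2) -zsE.
    apply: le_trans (ler_normD _ _) _.
    by rewrite [leRHS](_ : _ = 1 / 2 + 1 / 2) ?lerD//; lra.
  rewrite /Phi /penalized /= lerD2r lerD2l ler_pM2l// divr_gt0//.
- apply: limiting_normal_cone_frechet => // e epos.
  pose dir (y : ('rV[R]_(s + 1) * 'rV[R]_r) * ('rV[R]_r * R)) :=
    \sum_j y.2.1 0 j *: J j (lsubmx y.1.1) + y.2.2 *: (lsubmx y.1.1 - wb).
  have cdir : continuous dir.
    apply: continuous_fD; last first.
      exact: continuous_fZ cy22 (continuous_fcomp cy1 cdx).
    apply: continuous_sumr => j; apply: continuous_fZ.
      exact: continuous_coord.
    exact: (continuous_fcomp (continuous_fcomp cy1 cls) (cJ j)).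
  have dirl : dir l = \sum_j mu 0 j *: J j wb.
    by rewrite /dir /= les subrr scaler0 addr0.
  have [k _ [[[d1 d2] d3] d4]] := cluster_frequently 0%N Xcl
    (filterI (filterI (filterI (near_le _ _ _ cy11 d12) (near_le _ _ _ cy11 epos))
       (near_le _ _ _ cdir epos)) (near_le R^o _ _ cy22 epos)).
  have [[[Ek _] _] kmin] := Hx k.
  exists (x k).1, (row_mx (- dir (X k)) (- t k)%:M); split => //.
  + have -> : row_mx (- dir (X k)) (- t k)%:M = t k *: row_mx
        (- (\sum_j (k.+1%:R *: (c (lsubmx (x k).1) - (x k).2)) 0 j
             *: J j (lsubmx (x k).1) + (lsubmx (x k).1 - wb))) (- 1)%:M.
      rewrite scale_row_mx scale_scalar_mx mulrN1 scalerN scalerDr scaler_sumr.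
      congr (row_mx (- (_ + _)) _); apply: eq_bigr => j _.
      by rewrite scalerA mxE.
    apply: frechet_normalZ => //; apply: frechet_normal_penalized => //.
    apply: filterS (near_norm_le (x k).1 d12) => z zk Ez.
    apply: (kmin (z, (x k).2)); split; last by have [[_ []]] := Hx k.
    split => //=; rewrite -(subrKA (x k).1) -esE.
    apply: le_trans (ler_normD _ _) _.
    by rewrite [leRHS](_ : _ = 1 / 2 + 1 / 2) ?lerD//; lra.
  + by rewrite -/e0 -esE.
  + rewrite opp_row_mx add_row_mx -dirl -opprD -raddfB/=.
    apply: norm_row_mx; first by rewrite normrN.
    by rewrite norm_scalar_mx1 -opprD normrN.
Qed.

End MultiplierRule.

(** * Orthants and epigraphs *)

Section OrthantEpigraph.
Context {R : realType}.

(** Compare v with v + t d and let t be small; only the segment from v to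
    v + d has to lie in Om. *)
Lemma proj_set_variation s (Om : set 'rV[R]_s) w v d : proj_set Om w v ->
  (forall t, 0 <= t <= 1 -> Om (v + t *: d)) -> dot (w - v) d <= 0.
Proof.
move=> [_ vmin] Omd; rewrite leNgt; apply/negP => bd0.
have d0 := dot_ge0 d.
pose t := Num.min 1 (dot (w - v) d / (dot d d + 1)).
have dd1 : 0 < dot d d + 1 by lra.
have t0 : 0 < t by rewrite lt_min ltr01 divr_gt0.
have t1 : t <= 1 by rewrite ge_min lexx.
have td : t * (dot d d + 1) <= dot (w - v) d.
  by rewrite -ler_pdivlMr// ge_min lexx orbT.
have := vmin _ (Omd t _); rewrite t1 (ltW t0) => /(_ isT).
rewrite dot_dist_le opprD addrA.
move: (w - v) td bd0 => b td bd0.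
clearbody t.
rewrite !(dotDl, dotDr, dotNl, dotNr, dotZl, dotZr) (dotC d b).
nra.
Qed.

Definition neg_orthant s : set 'rV[R]_s := [set z | vec_le z 0].

Lemma closed_neg_orthant s : closed (@neg_orthant s).
Proof. exact: closed_vec_le (fun z => cvg_id) (@cst_continuous _ _ _). Qed.

Lemma neg_orthant_proj s (w v : 'rV[R]_s) i : proj_set (@neg_orthant s) w v ->
  [/\ 0 <= (w - v) 0 i, v 0 i <= 0 & (w - v) 0 i * v 0 i = 0].
Proof.
move=> vP; have [/forallP/= v0 _] := vP.
have vi : v 0 i <= 0 by have := v0 i; rewrite mxE.
have wv : 0 <= (w - v) 0 i.
  (* lowering a coordinate stays in the orthant *)
  have := proj_set_variation (d := - delta_mx 0 i) vP.
  rewrite dotNr dotC dot_delta oppr_le0; apply => t /andP[t0 _].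
  apply/forallP => j; rewrite !mxE eqxx/=; have := v0 j; rewrite mxE.
  by case: (j == i); rewrite /= ?mulr1n ?mulr0n; lra.
split => //; apply/le_anti/andP; split; first by nra.
(* so does moving a coordinate to 0 *)
have := proj_set_variation (d := - v 0 i *: delta_mx 0 i) vP.
rewrite dotZr dotC dot_delta mulNr oppr_le0 mulrC; apply => t /andP[t0 t1].
apply/forallP => j; rewrite !mxE eqxx/=; have := v0 j; rewrite mxE.
have [->|] := eqVneq j i; rewrite /= ?mulr1n ?mulr0n; nra.
Qed.

(** Signs pass to the limit. If zb_i < 0, then w_i < 0 for w near zb, and the
    residual of the projection of w vanishes in coordinate i: were it
    positive, complementarity would give v_i = 0 < w_i. *)
Lemma neg_orthant_normal s (zb mu : 'rV[R]_s) i : neg_orthant zb ->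
  limiting_normal_cone (@neg_orthant s) zb mu ->
  0 <= mu 0 i /\ mu 0 i * zb 0 i = 0.
Proof.
move=> zb0 [wk [vk [al [wkz vkP al0 alm]]]].
have close e : 0 < e -> exists k, `|wk k 0 i - zb 0 i| <= e /\
    `|al k * (wk k - vk k) 0 i - mu 0 i| <= e.
  move=> e0; have /cvgrPdist_le/(_ e e0) A := wkz.
  have /cvgrPdist_le/(_ e e0) B := alm.
  have [N _ H] := filterI A B; exists N.
  have [/= h1 h2] := H N (leqnn N); split; rewrite distrC.
    by have := le_trans (norm_coord _ i) h1; rewrite !mxE.
  by have := le_trans (norm_coord _ i) h2; rewrite !mxE.
have zi : zb 0 i <= 0 by have /forallP/(_ i) := zb0; rewrite mxE.
split.
  rewrite leNgt; apply/negP => mu0.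
  have [k [_]] : exists k, `|wk k 0 i - zb 0 i| <= - mu 0 i / 2 /\
    `|al k * (wk k - vk k) 0 i - mu 0 i| <= - mu 0 i / 2 by apply: close; lra.
  have [h _ _] := neg_orthant_proj i (vkP k).
  have := mulr_ge0 (ltW (al0 k)) h.
  rewrite ler_norml => h1 /andP[h2 h3]; lra.
have [->|z0] := eqVneq (zb 0 i) 0; first by rewrite mulr0.
have {z0}zi : zb 0 i < 0 by rewrite lt_neqAle z0.
suff -> : mu 0 i = 0 by rewrite mul0r.
apply/eqP; rewrite -normr_eq0 eq_le normr_ge0 andbT leNgt; apply/negP => mu0.
have [|k [h1 h2]] := close (Num.min (`|mu 0 i| / 2) (- zb 0 i / 2)).
  by rewrite lt_min; apply/andP; split; lra.
have {}h1 : `|wk k 0 i - zb 0 i| <= - zb 0 i / 2.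
  by apply: le_trans h1 _; rewrite ge_min lexx orbT.
have {}h2 : `|al k * (wk k - vk k) 0 i - mu 0 i| <= `|mu 0 i| / 2.
  by apply: le_trans h2 _; rewrite ge_min lexx.
have [k1 k2 k3] := neg_orthant_proj i (vkP k).
have wi : wk k 0 i < 0 by move: h1; rewrite ler_norml => /andP[]; lra.
have b0 : (wk k - vk k) 0 i = 0.
  by apply/eqP; move: k3 => /eqP; rewrite mulf_eq0 => /orP[//|/eqP vi];
    move: k1; rewrite !mxE vi; lra.
move: h2; rewrite b0 mulr0 sub0r normrN; lra.
Qed.

Lemma closed_epigraph s (h : 'rV[R]_s -> R) : continuous h ->
  closed (epigraph (fun v => (h v)%:E)).
Proof.
move=> ch.
have -> : epigraph (fun v => (h v)%:E) = [set z | h (lsubmx z) <= height z].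
  by apply/seteqP; split => z; rewrite /epigraph /height /= lee_fin.
apply: closed_fle; last exact: continuous_height.
exact: continuous_fcomp (@continuous_lsubmx _ _ _ _) ch.
Qed.

(** The function (v, alpha) |-> h v - alpha has gradient (a, -1), is nonpositive
    on the epigraph of h and vanishes on the graph. *)
Lemma has_grad_limiting_subdiff s (h : 'rV[R]_s -> R) w a : continuous h ->
  has_grad h w a -> limiting_subdiff (fun v => (h v)%:E) w a.
Proof.
move=> ch ha; rewrite /limiting_subdiff /=.
set p := row_mx w _.
have pl : lsubmx p = w by rewrite row_mxKl.
have ph : height p = h w by rewrite /height row_mxKr mxE eqxx.
have wEpi : epigraph (fun v => (h v)%:E) p.
  by rewrite /epigraph /= lee_fin pl -ph.
apply: frechet_limiting => //; first exact: closed_epigraph.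
have hap : has_grad h (lsubmx p) a by rewrite pl.
have := has_gradD (has_grad_lsubmx hap) (has_gradZ (-1) (has_grad_height p)).
rewrite scaleN1r opp_row_mx add_row_mx oppr0 addr0 add0r -raddfN.
move/frechet_normal_local_max; apply.
apply: (@nearW _ (nbhs p)) => e; rewrite /epigraph /= lee_fin pl ph.
rewrite -/(height e); lra.
Qed.

End OrthantEpigraph.

(** * The value-function constraint *)

Section ValueConstraint.
Context {R : realType} {n m p : nat}.
Variables (f : 'rV[R]_(n + m) -> R) (g : 'rV[R]_(n + m) -> 'rV[R]_p).

(** The epigraph of chi as a system of inequalities between continuous
    functions, one for each y: chi is f minus an infimum over y, and is
    infinite unless u >= 0. *)
Lemma chi_leP (w : 'rV[R]_(n + m + p)) a :
  (chi f g w <= a%:E)%E <-> vec_le 0 (rsubmx w) /\ forall y,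
    f (lsubmx w) - Lagrangian f g (lsubmx (lsubmx w)) y (rsubmx w) <= a.
Proof.
have subl (r : R) (x : \bar R) : (r%:E - x <= a%:E)%E = ((r - a)%:E <= x)%E.
  case: x => [x||] /=; last 2 first.
  - by rewrite leey; apply/idP; rewrite leNye.
  - by rewrite !leNgt ltry ltNyr.
  by rewrite -EFinB !lee_fin lerBlDl lerBlDr.
rewrite /chi subl /psi_l; case: ifPn => [u0|nu0]; last first.
  by split=> [|[]//]; rewrite leNgt ltNyr.
split=> [/ereal_infP Lle|[_ Lle]].
  split => // y; have : ((f (lsubmx w) - a)%:E <=
      (Lagrangian f g (lsubmx (lsubmx w)) y (rsubmx w))%:E)%E.
    by apply: Lle; exists y.
  by rewrite lee_fin; lra.
apply/ereal_infP => _ [y _ <-]; rewrite lee_fin; have := Lle y; lra.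
Qed.

(** Weak duality: bounding the infimum by its value at the y-component of w gives
    chi(w) >= - <u, g(w)>. *)
Lemma chi_ge0 (w : 'rV[R]_(n + m + p)) a :
  vec_le (g (lsubmx w)) 0 -> (chi f g w <= a%:E)%E -> 0 <= a.
Proof.
move=> /forallP g0 /chi_leP[/forallP u0 /(_ (rsubmx (lsubmx w)))].
rewrite /Lagrangian hsubmxK.
have : \sum_i rsubmx w 0 i * g (lsubmx w) 0 i <= 0.
  apply: sumr_le0 => i _; apply: mulr_ge0_le0.
    by have := u0 i; rewrite [(0 : 'rV_p) 0 i]mxE.
  by have := g0 i; rewrite [(0 : 'rV_p) 0 i]mxE.
lra.
Qed.

Lemma chi_feasible x y u : vec_le (g (row_mx x y)) 0 -> vec_le 0 u ->
    ((f (row_mx x y))%:E <= psi_l f g x u)%E ->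
  chi f g (row_mx (row_mx x y) u) = 0%E.
Proof.
move=> g0 u0 fpsi.
have chi0 : (chi f g (row_mx (row_mx x y) u) <= 0)%E.
  rewrite /chi !row_mxKl row_mxKr; move: fpsi.
  case: (psi_l f g x u) => [r||] //=; first by rewrite -EFinB !lee_fin subr_le0.
  by rewrite leNye.
apply/le_anti/andP; split => //.
rewrite leNgt; apply/negP => chi_lt0.
have [a a0 chia] : exists2 a : R, a < 0 &
    (chi f g (row_mx (row_mx x y) u) <= a%:E)%E.
  move: chi_lt0; case: (chi f g _) => [r||]//.
    by rewrite lte_fin => r0; exists r.
  by move=> _; exists (-1); rewrite ?leNye// oppr_lt0 ltr01.
have := chi_ge0 _ chia; rewrite row_mxKl => /(_ g0); lra.
Qed.

Hypotheses (cf : continuous f) (cg : continuous g).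

Lemma closed_epigraph_chi : closed (epigraph (chi f g)).
Proof.
have -> : epigraph (chi f g) =
    [set z | vec_le 0 (rsubmx (lsubmx z))] `&`
    [set z | forall y, f (lsubmx (lsubmx z)) - Lagrangian f g
       (lsubmx (lsubmx (lsubmx z))) y (rsubmx (lsubmx z)) <= height z].
  by apply/seteqP; split => z; rewrite /epigraph /height /= => /chi_leP.
have cw := @continuous_lsubmx R 1 (n + m + p) 1.
have cxy := continuous_fcomp cw (@continuous_lsubmx R 1 (n + m) p).
have cu := continuous_fcomp cw (@continuous_rsubmx R 1 (n + m) p).
have cx := continuous_fcomp cxy (@continuous_lsubmx R 1 n m).
apply: closedI; first by apply: closed_vec_le; [exact: cst_continuous|exact: cu].
apply: closed_forall => y; apply: closed_fle; last exact: continuous_height.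
have cxy' := continuous_row_mx cx (@cst_continuous _ _ y).
apply: (@continuous_fB _ _ R^o); first exact: continuous_fcomp cxy cf.
apply: (@continuous_fD _ _ R^o); first exact: continuous_fcomp cxy' cf.
exact: (continuous_dot cu (continuous_fcomp cxy' cg)).
Qed.

Lemma closed_calF : closed (calF g).
Proof.
apply: closedI; apply: closed_vec_le.
- exact: continuous_fcomp (@continuous_lsubmx _ _ _ _) cg.
- exact: cst_continuous.
- exact: cst_continuous.
- exact: continuous_rsubmx.
Qed.

End ValueConstraint.

(** * Violation of the constraint qualification *)

Lemma C1_continuous (R : realType) s (h : 'rV[R]_s -> R) : C1 h -> continuous h.
Proof. by move=> [dh _] w; exact: differentiable_continuous. Qed.

Theorem theorem4p5 (R : realType) (n m p q : nat)
    (f : 'rV[R]_(n + m) -> R) (g : 'rV[R]_(n + m) -> 'rV[R]_p)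
    (G : 'rV[R]_n -> 'rV[R]_q)
    (f_C2 : C2 f)
    (g_C2 : forall i, C2 (fun z => g z 0 i))
    (G_C1 : forall i, C1 (fun x => G x 0 i))
    (f_convex : forall x, upper_set G x ->
       convex_function setT (fun y : 'rV[R]_m => f (row_mx x y)))
    (g_convex : forall x i, upper_set G x ->
       convex_function setT (fun y : 'rV[R]_m => g (row_mx x y) 0 i))
    (xb : 'rV[R]_n) (yb : 'rV[R]_m) (ub : 'rV[R]_p)
    (feasible : LD_feasible f g G xb yb ub)
    (qualification :
       singular_subdiff (chi f g) (row_mx (row_mx xb yb) ub) `&`
       [set - eta | eta in
          limiting_normal_cone (calF g) (row_mx (row_mx xb yb) ub)]
       = [set 0]) :
  NSMFCQ_violated (LD_system f g G) (row_mx (row_mx xb yb) ub).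
Proof.
have [Gxb gb0 ub0 fpsi] := feasible.
have cf : continuous f by exact: C1_continuous f_C2.1.
have cgi i : continuous (fun z => g z 0 i) by exact: C1_continuous (g_C2 i).1.
have cg : continuous g by exact: continuous_rowP.
set w := row_mx (row_mx xb yb) ub in qualification *.
have wxy : lsubmx w = row_mx xb yb by rewrite row_mxKl.
have wx : lsubmx (lsubmx w) = xb by rewrite wxy row_mxKl.
have wu : rsubmx w = ub by rewrite row_mxKr.
have chiw : chi f g w = 0%E by exact: chi_feasible.
have Ecl := closed_epigraph_chi cf cg.
have Ew : epigraph (chi f g) (row_mx w 0%:M).
  by rewrite /epigraph /= row_mxKl row_mxKr chiw mxE eqxx lexx.
have Fw : calF g w by rewrite /calF /= wxy wu.
have Fcl := @closed_calF R n m p g cg.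
have chi_pos e : epigraph (chi f g) e -> vec_le (g (lsubmx (lsubmx e))) 0 ->
    0 <= height e by move=> /[swap]; exact: chi_ge0.
have qual eta : limiting_normal_cone (epigraph (chi f g)) (row_mx w 0%:M)
      (row_mx (- eta) 0%:M) ->
    limiting_normal_cone (calF g) w eta -> eta = 0.
  move=> h1 h2; apply/eqP; rewrite -oppr_eq0; apply/eqP.
  have : [set (0 : 'rV[R]_(n + m + p))] (- eta); last by [].
  rewrite -qualification; split; last by exists eta.
  by rewrite /singular_subdiff /= chiw.
have subdiffP tau eta : 0 < tau ->
    limiting_normal_cone (epigraph (chi f g)) (row_mx w 0%:M)
      (row_mx eta (- tau)%:M) ->
    limiting_subdiff (chi f g) w (tau^-1 *: eta).
  move=> tau0 /(limiting_normal_coneZ (k := tau^-1)).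
  rewrite scale_row_mx scale_scalar_mx mulrN mulVf ?gt_eqF// invr_gt0.
  by move=> /(_ tau0) h; rewrite /limiting_subdiff /= chiw.
(* chi has a subgradient at w: first use of the multiplier rule *)
have [eta0 eta0P] : limiting_subdiff (chi f g) w !=set0.
  have [||mu [tau [tau0 mu0 muF muE]]] := @multiplier_rule R _ _
    (epigraph (chi f g)) (calF g) id (fun j _ => delta_mx 0 j) w Ecl Fcl
    (fun w => cvg_id) (fun j => @cst_continuous _ _ _) _ Ew Fw _.
    move=> j v; have -> : (fun v : 'rV[R]_(n + m + p) => v 0 j) =
        dot (delta_mx 0 j).
      by apply/funext => v'; rewrite dot_delta.
    exact: has_grad_dot.
  by move=> e Ee [/= ge _]; exact: chi_pos.
  move: muE; rewrite -row_sum_delta => muE.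
  exists (tau^-1 *: - mu); apply: subdiffP => //.
  rewrite lt_neqAle tau0 andbT eq_sym; apply/negP => /eqP tau00.
  move: muE (mu0 tau00); rewrite tau00 oppr0 => muE /eqP; apply.
  exact: qual.
(* multipliers for g: second use of the multiplier rule *)
pose Dg (i : 'I_p) (v : 'rV[R]_(n + m + p)) : 'rV[R]_(n + m + p) :=
  row_mx (grad (fun z => g z 0 i) (lsubmx v)) 0.
have gDg i v : has_grad (fun v => g (lsubmx v) 0 i) v (Dg i v).
  apply: (@has_grad_lsubmx _ _ _ (fun z => g z 0 i)).
  by apply: differentiable_has_grad; exact: (g_C2 i).1.1.
have cDg i : continuous (Dg i).
  apply: continuous_row_mx; last exact: cst_continuous.
  exact: (continuous_fcomp (@continuous_lsubmx _ _ _ _) (g_C2 i).1.2).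
have cgl : continuous (fun v : 'rV[R]_(n + m + p) => g (lsubmx v)).
  exact: (continuous_fcomp (@continuous_lsubmx _ _ _ _) cg).
have Zw : neg_orthant (g (lsubmx w)) by rewrite /neg_orthant /= wxy.
have [mu [tau [tau0 mu0 muZ muE]]] := @multiplier_rule R _ _
  (epigraph (chi f g)) (@neg_orthant R p) _ Dg w Ecl (@closed_neg_orthant R p)
  cgl cDg gDg Ew Zw chi_pos.
set zeta := \sum_j mu 0 j *: Dg j w in muE.
have mu_ge0 i : 0 <= mu 0 i.
  by have [] := neg_orthant_normal i Zw muZ.
have mu_compl i : mu 0 i * g (lsubmx w) 0 i = 0.
  by have [] := neg_orthant_normal i Zw muZ.
(* by complementarity, the function with gradient zeta given by the sum of the
   mu_j g_j is maximal over F at w *)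
have zetaF : limiting_normal_cone (calF g) w zeta.
  apply: frechet_limiting => //.
  have := has_grad_sum (fun i => has_gradZ (mu 0 i) (gDg i w)).
  move/frechet_normal_local_max; apply.
  apply: (@nearW _ (nbhs w)) => v [/forallP gv _].
  apply: ler_sum => i _; rewrite mu_compl; apply: mulr_ge0_le0 => //.
  by have := gv i; rewrite [(0 : 'rV_p) 0 i]mxE.
have [eta1 eta1P zetaE] : exists2 eta, limiting_subdiff (chi f g) w eta &
    zeta + tau *: eta = 0.
  have [tau00|taun0] := eqVneq tau 0.
    exists eta0; first exact: eta0P.
    rewrite tau00 scale0r addr0; apply: qual; last exact: zetaF.
    by move: muE; rewrite tau00 oppr0.
  exists (tau^-1 *: - zeta); last by rewrite scalerA mulfV// scale1r subrr.
  by apply: subdiffP => //; rewrite lt_def taun0.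
split.
- case=> [[[i|i]|i]|[]] /=.
  + by rewrite lee_fin wx; have /forallP/(_ i) := Gxb; rewrite mxE.
  + by rewrite lee_fin wxy; have /forallP/(_ i) := gb0; rewrite mxE.
  + by rewrite lee_fin oppr_le0 wu; have /forallP/(_ i) := ub0; rewrite mxE.
  + by rewrite chiw.
- by case=> [[[i|i]|i]|[]] //=; rewrite chiw.
move=> cq.
pose v (c : @LD_index p q) : R :=
  match c with inl (inl (inr i)) => mu 0 i | inr _ => tau | _ => 0 end.
pose eta (c : @LD_index p q) : 'rV[R]_(n + m + p) :=
  match c with
  | inl (inl (inl i)) =>
      row_mx (row_mx (grad (fun x => G x 0 i) (lsubmx (lsubmx w))) 0) 0
  | inl (inl (inr i)) => Dg i w
  | inl (inr i) => -1 *: row_mx 0 (delta_mx 0 i)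
  | inr _ => eta1
  end.
have v0 : forall c, v c = 0.
  apply: (cq v eta).
  - case=> [[[i|i]|i]|[]]; last exact: eta1P.
    + apply: (@has_grad_limiting_subdiff _ _ (fun v => G (lsubmx (lsubmx v)) 0 i)).
        apply: (continuous_fcomp _ (C1_continuous (G_C1 i))).
        exact: (continuous_fcomp (@continuous_lsubmx R 1 _ _)
          (@continuous_lsubmx R 1 _ _)).
      apply: (@has_grad_lsubmx _ _ _ (fun z => G (lsubmx z) 0 i)).
      apply: (@has_grad_lsubmx _ _ _ (fun x => G x 0 i)).
      by apply: differentiable_has_grad; exact: (G_C1 i).1.
    + apply: (@has_grad_limiting_subdiff _ _ (fun v => g (lsubmx v) 0 i)).
        exact: continuous_coord.
      exact: gDg.
    + have -> : LD_system f g G (inl (inr i)) =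
          fun v => (-1 * dot (row_mx 0 (delta_mx 0 i)) v)%:E.
        apply/funext => v'; rewrite /LD_system -[v' in RHS]hsubmxK dot_row_mx.
        by rewrite dot0l add0r dot_delta mulN1r.
      apply: has_grad_limiting_subdiff; last first.
        by apply: has_gradZ; exact: has_grad_dot.
      have cd : continuous (dot (row_mx (0 : 'rV[R]_(n + m)) (delta_mx 0 i))).
        exact: (continuous_dot (@cst_continuous _ _ _) (fun v => cvg_id)).
      exact: (@continuous_fZ _ _ R^o (cst (-1)) _ (@cst_continuous _ _ _) cd).
  - rewrite !big_sumType/= (big_pred1 tt); last by case.
    have sum0 k (a : 'I_k -> 'rV[R]_(n + m + p)) : \sum_i (0 : R) *: a i = 0.
      by rewrite big1// => i _; rewrite scale0r.
    by rewrite !sum0 add0r addr0.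
  - by case=> [[[i|i]|i]|[]] /=.
  - case=> [[[i|i]|i]|[]] /=; rewrite ?mul0e//.
      by rewrite -EFinM mu_compl.
    by rewrite chiw mule0.
have /mu0/eqP := v0 (inr tt); apply.
by apply/rowP => i; rewrite mxE; exact: (v0 (inl (inl (inr i)))).
Qed.
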